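(* Let $n\ge 1$, let $\rho=(n,n-1,\ldots,1)$ be the staircase partition, and let $\mu\subseteq\rho$ be any subpartition. Then $$G_{\rho/\mu}=G_{\rho/\mu^T},$$ where $G_{\lambda/\mu}$ denotes the skew stable Grothendieck polynomial and $\mu^T$ is the conjugate partition of $\mu$.
   Context: For partitions, $\mu\subseteq\lambda$ means $\mu_i\le\lambda_i$ for all $i$; the skew Young diagram $Y(\lambda/\mu)$ consists of the cells of the (left-aligned, English-convention) Young diagram of $\lambda$ not in that of $\mu$, and $|\lambda/\mu|=|\lambda|-|\mu|$. The conjugate $\mu^T$ is obtained by reflecting the Young diagram over the main diagonal. For nonempty finite sets $A,B$ of positive integers, write $A\le B$ if $\max A\le\min B$, and $A<B$ if $\max A<\min B$. A set-valued tableau of shape $\lambda/\mu$ is a filling of the cells of $Y(\lambda/\mu)$ with nonempty finite sets of positive integers that weakly increase ($\le$) along rows from left to right and strictly increase ($<$) down columns. For such $T$, let $|T|$ be the sum of the sizes of the sets appearing in $T$ and $x^T=\prod_i x_i^{m_i}$, where $m_i$ is the number of times $i$ appears in $T$. The skew stable Grothendieck polynomial is the formal power series $G_{\lambda/\mu}=\sum_T(-1)^{|T|-|\lambda/\mu|}x^T$, summed over all set-valued tableaux $T$ of shape $\lambda/\mu$. *)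

(* Defs.v *)
From mathcomp Require Import all_boot all_order all_algebra.
From mathcomp Require Import finmap.
From mathcomp Require Import monalg.
From mathcomp Require Import classical_sets functions cardinality fsbigop.

Set Implicit Arguments.
Unset Strict Implicit.
Unset Printing Implicit Defensive.

Import GRing.Theory.
Local Open Scope ring_scope.

Section Partitions.
Local Open Scope nat_scope.
Implicit Types lam mu : seq nat.

(* A partition is the sequence of its nonzero parts, in weakly decreasing
   order; the parts past the end are 0, so that mu_i is nth 0 mu i.  Rows and
   columns are numbered from 0. *)
Definition is_partition mu : bool := sorted geq mu && (0 \notin mu).

Definition subpartition mu lam : Prop := forall i, nth 0 mu i <= nth 0 lam i.

Definition staircase (n : nat) : seq nat := rev (iota 1 n).

Definition young (mu : seq nat) : pred (nat * nat) :=
  fun c => c.2 < nth 0 mu c.1.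

(* The j-th part is the length of the j-th column of the diagram of mu;
   conjugateP says that this is the reflection in the main diagonal. *)
Definition conjugate mu : seq nat :=
  [seq count (fun p => j < p) mu | j <- iota 0 (head 0 mu)].

Lemma nth_conjugate mu j : is_partition mu ->
  nth 0 (conjugate mu) j = count (fun p => j < p) mu.
Proof.
case/andP=> smu _; have [lt_j | le_j] := ltnP j (head 0 mu).
  by rewrite (nth_map 0) ?size_iota // nth_iota.
rewrite nth_default ?size_map ?size_iota //; apply/esym/eqP.
rewrite -leqn0 leqNgt -has_count; apply/hasPn => p.
case: mu smu le_j => // a mu /= smu le_aj; rewrite -leqNgt inE => /orP[/eqP->//|].
have geqT : transitive geq by move=> x y z xy yz; exact: leq_trans yz xy.
by move/(allP (order_path_min geqT smu)) => /= le_pa; exact: leq_trans le_aj.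
Qed.

Lemma conjugateP mu i j : is_partition mu ->
  young (conjugate mu) (i, j) = young mu (j, i).
Proof.
move=> pmu; rewrite /young /= nth_conjugate //; case/andP: pmu => smu _.
have geqT : transitive geq by move=> x y z xy yz; exact: leq_trans yz xy.
elim: mu j smu => [|a mu IH] j /= smu; first by rewrite nth_nil.
have /allP amu := order_path_min geqT smu.
have [lt_ia | le_ai] := ltnP i a.
  by case: j => [|j] /=; rewrite add1n // ltnS IH // (path_sorted smu).
have /eqP->: count (fun p => i < p) mu == 0.
  rewrite -leqn0 leqNgt -has_count; apply/hasPn => p /amu /= le_pa.
  by rewrite -leqNgt; exact: leq_trans le_ai.
rewrite ltn0; case: j => [|j] /=; first by rewrite ltnNge le_ai.
have [lt_j | le_j] := ltnP j (size mu); last by rewrite nth_default.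
by apply/esym/negbTE; rewrite -leqNgt (leq_trans (amu _ (mem_nth 0 lt_j))).
Qed.

Lemma conjugate_partition mu : is_partition mu -> is_partition (conjugate mu).
Proof.
move=> pmu; apply/andP; split.
  rewrite /conjugate; move: (head 0 mu) => k.
  apply: (homo_sorted (e := leq)); last exact: iota_sorted.
  move=> i j le_ij /=; apply: sub_count => p /=; exact: leq_ltn_trans.
apply/mapP => -[j]; rewrite mem_iota add0n /= => lt_j /esym/eqP.
rewrite -leqn0 leqNgt -has_count => /hasPn; case: {pmu} mu lt_j => // a mu /=.
by move=> lt_ja /(_ a (mem_head _ _)); rewrite lt_ja.
Qed.

End Partitions.

Section SetValuedTableaux.
Local Open Scope nat_scope.
Local Open Scope fset_scope.

(* On nonempty sets these are the maximum and the minimum. *)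
Definition fmax (A : {fset nat}) : nat := \max_(a <- A) a.
Definition fmin (A : {fset nat}) : nat := \big[minn/fmax A]_(a <- A) a.

Definition set_le (A B : {fset nat}) : bool := fmax A <= fmin B.
Definition set_lt (A B : {fset nat}) : bool := fmax A < fmin B.

Lemma leq_fmax (A : {fset nat}) a : a \in A -> a <= fmax A.
Proof. by move=> aA; rewrite /fmax (big_rem a) //= leq_maxl. Qed.

Lemma geq_fmin (A : {fset nat}) a : a \in A -> fmin A <= a.
Proof.
rewrite /fmin; move: (fmax A) => k; rewrite -[a \in A]/(a \in enum_fset A).
elim: (enum_fset A) => // b s IH; rewrite big_cons inE => /orP[/eqP<-|/IH le_a].
  exact: geq_minl.
exact: leq_trans (geq_minr _ _) le_a.
Qed.

Lemma fmax_in (A : {fset nat}) : A != fset0 -> fmax A \in A.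
Proof.
case/fset0Pn => a aA; rewrite /fmax big_seq.
have : (\big[maxn/0]_(i <- A | i \in A) i = 0)
    \/ (\big[maxn/0]_(i <- A | i \in A) i \in A).
  apply: (big_ind (fun x => x = 0 \/ x \in A)); [by left| |by right].
  move=> x y Px Py; rewrite /maxn; by case: ifP.
case=> // max0; rewrite max0; have := leq_fmax aA.
by rewrite /fmax big_seq max0 leqn0 => /eqP <-.
Qed.

Lemma fmin_in (A : {fset nat}) : A != fset0 -> fmin A \in A.
Proof.
move=> A0; rewrite /fmin big_seq.
apply: (big_ind (fun x => x \in A)) => //; first exact: fmax_in.
by move=> x y Px Py; rewrite /minn; case: ifP.
Qed.

Definition skew_diagram (lam mu : seq nat) : {fset nat * nat} :=
  [fset c in [seq (i, j) | i <- iota 0 (size lam), j <- iota 0 (nth 0 lam i)]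
     | ~~ young mu c].

Lemma in_skew_diagram lam mu c :
  (c \in skew_diagram lam mu) = young lam c && ~~ young mu c.
Proof.
rewrite !inE; congr (_ && _); case: c => i j; rewrite /young /=.
apply/allpairsPdep/idP => [[x [y []]]|lt_j].
  by rewrite !mem_iota !add0n => _ lt_y [-> ->].
exists i, j; rewrite !mem_iota !add0n; split=> //.
by rewrite ltnNge; apply: contraTN lt_j => le_i; rewrite nth_default.
Qed.

Definition skew_size (lam mu : seq nat) : nat := sumn lam - sumn mu.

Definition filling (lam mu : seq nat) : choiceType :=
  {ffun skew_diagram lam mu -> {fset nat}}.

Variables lam mu : seq nat.
Implicit Type T : filling lam mu.

Definition is_svt T : Prop :=
  [/\ forall c, T c != fset0,
      forall c i, i \in T c -> 0 < i,
      forall c d, (val c).1 = (val d).1 -> (val c).2 < (val d).2 ->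
        set_le (T c) (T d)
    & forall c d, (val c).2 = (val d).2 -> (val c).1 < (val d).1 ->
        set_lt (T c) (T d)].

Definition svt_size T : nat := \sum_c #|` T c|.

Definition multiplicity T (i : nat) : nat := #|[pred c | i \in T c]|.

Definition svt_monomial T : {cmonom nat} :=
  [cmonom multiplicity T i | i in (\bigcup_(c <- enum {: skew_diagram lam mu}) T c)%fset]%M.

Lemma svt_monomialE T i : svt_monomial T i = multiplicity T i.
Proof.
rewrite /svt_monomial cmE /= fsfunE; case: ifPn => // /bigfcupP Ti.
apply/esym/eqP; apply/eqP/eq_card0 => c.
rewrite !inE; apply/negP => iTc; apply: Ti; exists c => //.
by rewrite mem_enum.
Qed.

End SetValuedTableaux.

(* Formal power series with integer coefficients in the variables x_i
   (i : nat), given by their coefficients.  The variable x_0 does not occur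
   in the series below, as the entries of a tableau are positive. *)
Definition power_series : Type := {cmonom nat} -> int.

(* The coefficient of m collects the tableaux T with x^T = m.  The sum
   \sum_(T \in A) is 0 by convention when infinitely many terms are nonzero,
   which finite_svt_monomial excludes. *)
Definition stable_grothendieck (lam mu : seq nat) : power_series :=
  fun m => \sum_(T \in [set T : filling lam mu | is_svt T /\ svt_monomial T = m]%classic)
             ((-1) ^+ (svt_size T - skew_size lam mu) : int).

Lemma finite_svt_monomial lam mu (m : {cmonom nat}) :
  finite_set [set T : filling lam mu | is_svt T /\ svt_monomial T = m]%classic.
Proof.
pose S := finsupp m.
pose g (h : {ffun skew_diagram lam mu -> fpowerset S}) : filling lam mu :=
  [ffun c => val (h c)].
apply: (@sub_finite_set _ _ (g @` setT)%classic); last first.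
  by apply: finite_image; exact: finite_finset.
move=> T [_ Tm].
have TS c : T c \in fpowerset S.
  rewrite fpowersetE; apply/fsubsetP => i iTc.
  rewrite mem_finsupp -Tm svt_monomialE -lt0n.
  by apply/card_gt0P; exists c; rewrite inE.
exists [ffun c => [` TS c]%fset] => //.
by apply/ffunP => c; rewrite !ffunE.
Qed.

(* Main.v *)
From HB Require Import structures.
Require Import Defs.
From mathcomp Require Import all_boot all_algebra.
From mathcomp Require Import ring zify.
Set Implicit Arguments.
Unset Strict Implicit.
Unset Printing Implicit Defensive.
Import GRing.Theory.
Local Open Scope ring_scope.

(* Write rho/mu for the skew staircase.  A set-valued tableau is read off by
   running through the pairs (value, content) in increasing lexicographic order,
   starting from mu and occupying a cell when its least entry is met.  On sets
   of occupied cells, reading an entry of content c is an operator u_c: it adds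
   a cell of content c, or acts by -1 when such a cell of rho/mu is a removable
   corner, or acts by 0.  These operators satisfy u_c^2 = -u_c,
   u_c u_d = u_d u_c for |c - d| > 1 and u_c u_d u_c = 0 for |c - d| = 1, and
   G_{rho/mu} is the matrix coefficient from mu to rho of the product over the
   values i of B(x_i), where B(x) is the product of the 1 + x u_c in increasing
   order of c.  Conjugating mu replaces B(x) by the product A(x) in decreasing
   order.  The relations imply that A(x) commutes with A(y) and B(y); and
   A(x) delta = B(x) delta for the indicator function delta of rho, because the
   removable corners of rho have contents of the same parity, while the factors
   of the other parity act trivially.  Hence every B(x_i) can be exchanged for
   A(x_i). *)

(** * Products of 0-Hecke operators *)

(** Transfers a known equation to a goal whose two sides have the same difference, which [ring] can
    check. *)
Lemma eq_of_subr (V : zmodType) (a b c d : V) : a = b -> a - b = c - d -> c = d.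
Proof. by move=> -> /esym/eqP; rewrite subrr subr_eq0 => /eqP. Qed.

Section HeckeOperators.
Variables (R : comNzRingType) (X : finType).
Local Notation V := {ffun X -> R^o}.
Variable u : nat -> V -> V.
Hypothesis u_linear : forall i, linear (u i).
HB.instance Definition _ i := GRing.isLinear.Build R V V _ (u i) (u_linear i).
Hypothesis u_idem : forall i f, u i (u i f) = - u i f.
Hypothesis u_comm : forall i j f, (i.+1 < j)%N -> u i (u j f) = u j (u i f).
Hypothesis u_braid : forall i f, u i (u i.+1 (u i f)) = 0.
Hypothesis u_braidS : forall i f, u i.+1 (u i (u i.+1 f)) = 0.
Implicit Types (f : V) (x y : R).

Definition hfac x i f : V := f + x *: u i f.
(** The head of [s] is the outermost factor, so [hup] below is the product B(x) and [hdown] the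
    product A(x). *)
Definition hprod x (s : seq nat) f : V := foldr (hfac x) f s.
Definition hup x n f := hprod x (iota 0 n) f.
Definition hdown x n f := hprod x (rev (iota 0 n)) f.

Lemma hupS x n f : hup x n.+1 f = hup x n (hfac x n f).
Proof. by rewrite /hup /hprod -addn1 iotaD foldr_cat. Qed.

Lemma hdownS x n f : hdown x n.+1 f = hfac x n (hdown x n f).
Proof. by rewrite /hdown /hprod -addn1 iotaD rev_cat. Qed.

Lemma hprod_u x n s f : all (fun c => (n.+1 < c) || (c.+1 < n))%N s ->
  hprod x s (u n f) = u n (hprod x s f).
Proof.
elim: s => //= c s IH /andP[nc /IH->].
rewrite /hfac linearD linearZ /=; congr (_ + _ *: _).
by case/orP: nc => nc; [rewrite -u_comm|rewrite u_comm].
Qed.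

Lemma hprodD x s f g : hprod x s (f + g) = hprod x s f + hprod x s g.
Proof.
by elim: s => //= c s ->; rewrite /hfac linearD scalerDr addrACA.
Qed.

Lemma hprodZ x s a f : hprod x s (a *: f) = a *: hprod x s f.
Proof.
by elim: s => //= c s ->; rewrite /hfac linearZ /= scalerDr !scalerA mulrC.
Qed.

Lemma hprod_hfac x y n s f : all (fun c => (n.+1 < c) || (c.+1 < n))%N s ->
  hprod x s (hfac y n f) = hfac y n (hprod x s f).
Proof. by move=> far; rewrite /hfac hprodD hprodZ hprod_u. Qed.

Lemma hup_hfac x y n f : hup x n (hfac y n.+1 f) = hfac y n.+1 (hup x n f).
Proof. by apply/hprod_hfac/allP => c; rewrite mem_iota; lia. Qed.

Lemma hdown_hfac x y n f : hdown x n (hfac y n.+1 f) = hfac y n.+1 (hdown x n f).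
Proof. by apply/hprod_hfac/allP => c; rewrite mem_rev mem_iota; lia. Qed.

Lemma hfacE x i f : hfac x i f = f + x *: u i f. Proof. by []. Qed.

Lemma hfacM x y i f : hfac x i (hfac y i f) = hfac (x + y - x * y) i f.
Proof.
rewrite !hfacE linearD linearZ /= u_idem; apply/ffunP => S.
by rewrite !ffunE /GRing.scale /=; ring.
Qed.

(* Unlike the usual Yang-Baxter argument, this avoids inverting 1 - x. *)
Lemma hdown_comm x y n f : hdown x n (hdown y n f) = hdown y n (hdown x n f).
Proof.
elim: n f => [|[|n] IH] f //; first by
  rewrite !hdownS /hdown /= !hfacE !linearD !linearZ /= u_idem; apply/ffunP => S;
  rewrite !ffunE /GRing.scale /=; ring.
(* Let a, b be the operators of index [n.+1], [n]. The claim becomes (1+xa)(1+xb)(1+ya)p =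
   (1+ya)(1+yb)(1+xa)q, and the induction hypothesis says (1+xb)p = (1+yb)q. *)
rewrite !(hdownS _ n.+1) (hdownS x n (hfac _ _ _)) (hdownS y n (hfac _ _ _)) !hdown_hfac.
have := IH f; rewrite (hdownS x) (hdownS y n (hdown x _ _)).
rewrite -!/(hdown _ n.+1 _).
move: (hdown x n (hdown y n.+1 f)) (hdown y n (hdown x n.+1 f)) => p q pq.
(* Since p - q lies in the image of b, bab = 0 gives ba(p - q) = 0, and b^2 = -b gives b(p - q) =
   -(p - q). *)
have pq_b : p - q = u n (y *: q - x *: p).
  rewrite linearB !linearZ /=; apply: (eq_of_subr pq).
  by apply/ffunP => S; rewrite !hfacE !ffunE; ring.
have bapq : u n (u n.+1 p) = u n (u n.+1 q).
  by apply/subr0_eq; rewrite -!linearB /= pq_b u_braid.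
have abpq : u n.+1 (u n p) = u n.+1 (u n q) - u n.+1 p + u n.+1 q.
  have : u n.+1 (u n (p - q)) + u n.+1 (p - q) = 0 by rewrite -linearD /= pq_b u_idem addNr linear0.
  rewrite !linearB /= => e; apply: (eq_of_subr e).
  by apply/ffunP => S; rewrite !ffunE; ring.
have apq : u n.+1 p + x *: u n.+1 (u n p) = u n.+1 q + y *: u n.+1 (u n q).
  by have := congr1 (u n.+1) pq; rewrite !hfacE !linearD !linearZ.
have aba r : u n.+1 (u n (u n.+1 r)) = 0 by exact: u_braidS.
rewrite !hfacE !(linearD, linearZ) /= !(u_idem, aba, bapq) abpq.
rewrite abpq in apq.
(* After these substitutions the goal is [pq] plus x + y times [apq]. *)
apply: (eq_of_subr (congr2 (fun v w => v + (x + y) *: w) pq apq)).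
by apply/ffunP => S; rewrite !hfacE !ffunE /GRing.scale /=; ring.
Qed.

(** Peeling off the two largest indices leaves the Yang-Baxter equation (1+xb)(1+za)(1+yb) =
    (1+ya)(1+zb)(1+xa) with z = x + y - xy; both sides expand to 1 + z(a+b) + xz ba + yz ab. *)
Lemma hdown_hup_comm x y n f : hup x n (hdown y n f) = hdown y n (hup x n f).
Proof.
elim: n f => [|[|n] IH] f //; first by
  rewrite !(hdownS, hupS) /hdown /hup /= !hfacE !linearD !linearZ /= u_idem;
  apply/ffunP => S; rewrite !ffunE /GRing.scale /=; ring.
rewrite (hupS x n.+1) (hdownS y n.+1).
rewrite (hdownS y n.+1 (hup _ _ _)) (hupS x n.+1) -IH.
rewrite 2!(hupS x n) 2!(hdownS y n) (hdown_hfac y x) -(hup_hfac x y); congr (hup x n _).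
move: (hdown y n f) => g; rewrite !hfacM !hfacE !(linearD, linearZ) /=.
rewrite !u_idem u_braid u_braidS.
by apply/ffunP => S; rewrite !ffunE /GRing.scale /=; ring.
Qed.

(** * Exchanging the two products on a vector where they agree *)

Section Exchange.
Variables (n : nat) (g : V).
Hypothesis hup_hdown_g : forall x, hup x n g = hdown x n g.

(** Once the other factors are [hdown], the remaining [hup] commutes past them to [g], turns into
    [hdown] there, and commutes back. *)
Lemma foldr_hup_hdown s :
  foldr (fun x => hup x n) g s = foldr (fun x => hdown x n) g s.
Proof.
elim: s => //= x s ->.
transitivity (foldr (fun y => hdown y n) (hup x n g) s).
  by elim: s => //= y s IH; rewrite hdown_hup_comm IH.
by rewrite hup_hdown_g; elim: s => //= y s ->; rewrite hdown_comm.
Qed.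

End Exchange.
End HeckeOperators.

(** * Set-valued tableaux as Hecke words *)

Section CellOperators.
Variables (R : comNzRingType) (P : finType) (lt : rel P) (kappa : P -> nat).
Implicit Types (d e : P) (S : {set P}) (f : {ffun {set P} -> R^o}).

(** For an order ideal [S], this says that [d] is addable if it lies outside [S], and a removable
    corner if it lies in [S]. *)
Definition active d S : bool :=
  [forall e, (lt e d ==> (e \in S)) && (lt d e ==> (e \notin S))].

Lemma activeP d S :
  reflect ((forall e, lt e d -> e \in S) /\ (forall e, lt d e -> e \notin S))
          (active d S).
Proof.
apply: (iffP forallP) => [actS | [actS1 actS2] e].
  by split=> e; have /andP[/implyP ? /implyP] := actS e.
by apply/andP; split; apply/implyP; [exact: actS1 | exact: actS2].
Qed.

(** The action is on functions of the state: [f] is evaluated at the state reached after reading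
    [d]. In a composite the outermost operator is thus read first. *)
Definition add_cell d f : {ffun {set P} -> R^o} :=
  [ffun S => if active d S then (-1) ^+ (d \in S) * f (d |: S) else 0].

Lemma add_cell_linear d : linear (add_cell d).
Proof.
move=> a f g; apply/ffunP => S; rewrite !ffunE /GRing.scale /=.
by case: ifP => _; ring.
Qed.

HB.instance Definition _ d := GRing.isLinear.Build R
  {ffun {set P} -> R^o} {ffun {set P} -> R^o} _ (add_cell d) (add_cell_linear d).

Definition add_content c f : {ffun {set P} -> R^o} :=
  \sum_(d | kappa d == c) add_cell d f.

Lemma add_content_linear c : linear (add_content c).
Proof.
move=> a f g; rewrite /add_content scaler_sumr -big_split /=.
by apply: eq_bigr => d _; rewrite linearP.
Qed.

HB.instance Definition _ c := GRing.isLinear.Build R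
  {ffun {set P} -> R^o} {ffun {set P} -> R^o} _ (add_content c)
  (add_content_linear c).

Definition full_state : {ffun {set P} -> R^o} :=
  [ffun S => (S == [set: P])%:R].

(** * Products of operators as signed sums over sets of marks *)

Section MarkSum.
Variables (I : finType) (x : I -> R) (ltl : rel (I * nat)).
Hypotheses (ltxx : irreflexive lt) (ltlxx : irreflexive ltl)
  (ltl_trans : transitive ltl)
  (lt_content : forall d e, kappa d = kappa e -> d != e -> lt d e || lt e d).
Implicit Types (L : seq (I * nat)) (M : {set P * I}).

Definition letter (p : P * I) : I * nat := (p.2, kappa p.1).

(* A mark (d, i) stands for an entry i of the cell d.  Reading the letters
   (value, content) in increasing order, S is the set of cells already
   occupied and L the list of letters still to be read; M holds the marks
   coming from L, so only the cells outside S are required to meet M. *)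
Definition compatible L S M : bool :=
  [&& [forall p in M, letter p \in L],
      [forall d, (d \notin S) ==> [exists i, (d, i) \in M]],
      [forall p in M, forall q in M, lt p.1 q.1 ==> ltl (letter p) (letter q)]
    & [forall p in M, forall e, lt p.1 e ==> (e \notin S)]].

Lemma compatibleP L S M : reflect
  [/\ forall p, p \in M -> letter p \in L,
      forall d, d \notin S -> exists i, (d, i) \in M,
      forall p q, p \in M -> q \in M -> lt p.1 q.1 -> ltl (letter p) (letter q)
    & forall p e, p \in M -> lt p.1 e -> e \notin S]
  (compatible L S M).
Proof.
apply: (iffP and4P) => -[h1 h2 h3 h4]; split.
- by move=> p; exact: (forall_inP h1).
- by move=> d dS; apply/existsP; exact: (implyP (forallP h2 d)).
- by move=> p q pM qM; have /forall_inP/(_ q qM)/implyP := forall_inP h3 p pM.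
- by move=> p e pM; have /forallP/(_ e)/implyP := forall_inP h4 p pM.
- by apply/forall_inP.
- by apply/forallP => d; apply/implyP => /h2/existsP.
- by apply/forall_inP => p pM; apply/forall_inP => q qM; apply/implyP/h3.
- by apply/forall_inP => p pM; apply/forallP => e; apply/implyP/h4.
Qed.

(** The exponent has the parity of the number of marks minus the number of cells still to be
    occupied. *)
Definition mark_weight S M : R :=
  (-1) ^+ (#|M| + #|~: S|) * \prod_(p in M) x p.2.

Lemma compatible_uniq L S M i c d e : compatible L S M ->
  (d, i) \in M -> kappa d = c -> (e, i) \in M -> kappa e = c -> d = e.
Proof.
case/compatibleP => _ _ M3 _ dM kd eM ke.
apply/eqP/negPn/negP => de.
have /orP[lde|led] := lt_content (etrans kd (esym ke)) de.
  by have := M3 _ _ dM eM lde; rewrite /letter /= kd ke ltlxx.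
by have := M3 _ _ eM dM led; rewrite /letter /= kd ke ltlxx.
Qed.

(** As [(i, c)] is the least letter, the mark [(d, i)] is read first. A cell below [d] could only be
    marked later, so it must already be in [S]. *)
Lemma compatible_cons i c L S M d : pairwise ltl ((i, c) :: L) ->
  kappa d = c -> (d, i) \notin M ->
  compatible ((i, c) :: L) S ((d, i) |: M)
  = active d S && compatible L (d |: S) M.
Proof.
move=> /= /andP[/allP minL _] kd dM.
have nL q : q \in L -> ~ ltl q (i, c).
  by move=> qL q_ic; have := ltl_trans (minL _ qL) q_ic; rewrite ltlxx.
have ld : letter (d, i) = (i, c) by rewrite /letter /= kd.
apply/compatibleP/andP => [[M1 M2 M3 M4]|[/activeP[A1 A2] /compatibleP[M1 M2 M3 M4]]].
  have dM1 : (d, i) \in (d, i) |: M by exact: setU11.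
  have M1' p : p \in M -> letter p \in L.
    move=> pM; have := M1 p (setU1r _ pM); rewrite inE => /orP[/eqP lp|//].
    case: p pM lp => e j eM [ji ke]; move: eM; rewrite {}ji => eM.
    have ed : e != d by apply: contraNneq dM => <-.
    have keq : kappa e = kappa d by rewrite kd.
    have /orP[l|l] := lt_content keq ed.
      by have := M3 _ _ (setU1r _ eM) dM1 l; rewrite /letter /= keq ltlxx.
    by have := M3 _ _ dM1 (setU1r _ eM) l; rewrite /letter /= keq ltlxx.
  split.
    apply/activeP; split=> e; last by exact: (M4 (d, i)).
    move=> led; apply/negPn/negP => /M2[j]; rewrite in_setU1 xpair_eqE.
    case/orP=> [/andP[/eqP ed _]|eM]; first by rewrite ed ltxx in led.
    have := M3 _ _ (setU1r _ eM) dM1 led; rewrite ld; exact/nL/M1'.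
  apply/compatibleP; split=> //.
  - move=> e; rewrite in_setU1 negb_or => /andP[ed /M2[j]].
    by rewrite in_setU1 xpair_eqE (negbTE ed) /=; exists j.
  - by move=> p q pM qM; apply: M3; exact: setU1r.
  - move=> p e pM lpe; rewrite in_setU1 negb_or (M4 p) ?setU1r // andbT.
    apply/eqP => ed; rewrite ed in lpe.
    have := M3 _ _ (setU1r _ pM) dM1 lpe; rewrite ld; exact/nL/M1'.
split.
- move=> p; rewrite in_setU1 => /orP[/eqP->|/M1]; rewrite inE ?ld ?eqxx //.
  by move=> ->; rewrite orbT.
- move=> e eS; case: (eqVneq e d) => [->|ed]; first by exists i; exact: setU11.
  case: (M2 e); first by rewrite in_setU1 negb_or ed.
  by move=> j ejM; exists j; exact: setU1r.
- move=> p q; rewrite !in_setU1 => /orP[/eqP->|pM] /orP[/eqP->|qM] /=.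
  + by rewrite ltxx.
  + by move=> _; rewrite ld; exact/minL/M1.
  + by move=> /(M4 p d pM); rewrite setU11.
  + exact: M3.
- move=> p e; rewrite in_setU1 => /orP[/eqP->|pM] /=; first exact: A2.
  by move=> /(M4 p e pM); rewrite in_setU1 negb_or => /andP[].
Qed.

(** A mark in a new cell changes both terms of the exponent; one in an occupied cell changes only
    the first, whence the sign. *)
Lemma mark_weight_cons d i S M : (d, i) \notin M ->
  mark_weight S ((d, i) |: M)
  = (-1) ^+ (d \in S) * (x i * mark_weight (d |: S) M).
Proof.
move=> dM; rewrite /mark_weight big_setU1 //= cardsU1 dM.
have -> : #|~: S| = ((d \notin S) + #|~: (d |: S)|)%N.
  rewrite setCU; case: (boolP (d \in S)) => dS /=.
    by congr #|pred_of_set _|; apply/setP => e; rewrite !inE; case: eqP => // ->; rewrite dS.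
  by rewrite (cardsD1 d) inE dS setIC setDE.
by case: (d \in S); rewrite !exprD /= ?expr1 ?expr0; ring.
Qed.

Lemma sum_marks_cons i c L S d : pairwise ltl ((i, c) :: L) -> kappa d = c ->
  \sum_(M | compatible ((i, c) :: L) S M && ((d, i) \in M)) mark_weight S M
  = if active d S then (-1) ^+ (d \in S)
      * (x i * \sum_(M | compatible L (d |: S) M) mark_weight (d |: S) M)
    else 0.
Proof.
move=> ltL kd.
have dL : (i, c) \notin L.
  by case/andP: ltL => /allP minL _; apply/negP => /minL; rewrite ltlxx.
have dM M : compatible L (d |: S) M -> (d, i) \notin M.
  by case/compatibleP => M1 _ _ _; apply: contraNN dL => /M1; rewrite /letter /= kd.
rewrite (reindex_onto (fun M => (d, i) |: M) (fun M => M :\ (d, i))) /=; last first.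
  by move=> M /andP[_ diM]; rewrite setD1K.
transitivity (\sum_(M | active d S && compatible L (d |: S) M)
    (-1) ^+ (d \in S) * (x i * mark_weight (d |: S) M)).
  apply: eq_big => M.
    rewrite setU11 andbT; case: (boolP ((d, i) \in M)) => diM.
      rewrite [RHS](negbTE _) ?andbF //; last first.
        by apply/negP => /andP[_ /dM]; rewrite diM.
      by apply/negbTE/negP => /andP[_ /eqP E]; rewrite -E setD11 in diM.
    by rewrite setU1K // eqxx andbT compatible_cons.
  case/andP=> _ /eqP E; rewrite mark_weight_cons //.
  by rewrite -E setD11.
by case: (active d S); rewrite ?big_pred0_eq // -!mulr_sumr.
Qed.

(** The first letter is either skipped, which is the identity term of [hfac], or marks exactly one
    cell of its content, which is a term of [add_content]. *)
Lemma sum_marks L S : pairwise ltl L ->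
  foldr (fun l => hfac add_content (x l.1) l.2) full_state L S
  = \sum_(M | compatible L S M) mark_weight S M.
Proof.
elim: L S => [|[i c] L IH] S ltL.
  rewrite ffunE; have cE M : compatible [::] S M = (S == setT) && (M == set0).
    apply/compatibleP/andP => [[M1 M2 _ _]|[/eqP-> /eqP->]]; last first.
      by split=> // p; rewrite ?inE.
    have M0 : M = set0 by apply/setP => p; rewrite inE; apply/negP => /M1.
    rewrite M0 eqxx; split=> //; apply/eqP/setP => d; rewrite inE.
    by apply/negPn/negP => /M2[j]; rewrite M0 inE.
  rewrite (eq_bigl _ _ cE); case: eqP => [->|_] /=; last by rewrite big_pred0_eq.
  by rewrite big_pred1_eq /mark_weight big_set0 cards0 setCT cards0 mul1r.
have ltL' : pairwise ltl L by case/andP: ltL.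
have dL : (i, c) \notin L.
  by case/andP: ltL => /allP minL _; apply/negP => /minL; rewrite ltlxx.
rewrite [LHS]ffunE /= ffunE [in LHS]IH // /add_content sum_ffunE.
pose used M := [exists d, (kappa d == c) && ((d, i) \in M)].
rewrite [RHS](bigID used) /= addrC; congr (_ + _).
  apply: eq_bigl => M; apply/compatibleP/andP => [[M1 M2 M3 M4]|].
    split; last first.
      apply/negP => /existsP[d /andP[/eqP kd /M1]].
      by rewrite /letter /= kd (negbTE dL).
    by apply/compatibleP; split=> // p /M1; rewrite inE => ->; rewrite orbT.
  case=> /compatibleP[M1 M2 M3 M4] /existsPn nu; split=> // -[d j] dM.
  have := M1 _ dM; rewrite inE => /orP[/eqP[ji kd]|//].
  by have := nu d; rewrite kd eqxx -ji dM.
(* Cells of equal content are comparable, so the inner sum has one term if [M] uses the first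
   letter, and none otherwise. *)
transitivity (\sum_(M | compatible ((i, c) :: L) S M)
    \sum_(d | (kappa d == c) && ((d, i) \in M)) mark_weight S M); last first.
  rewrite (bigID used) /= addrC big1 ?add0r; last first.
    move=> M /andP[_ /existsPn nu]; apply: big_pred0 => d.
    exact: negbTE (nu d).
  apply: eq_bigr => M /andP[cM /existsP[d /andP[/eqP kd dM]]].
  rewrite (big_pred1 d) // => e /=; apply/andP/eqP => [[/eqP ke eM]|->].
    exact: (compatible_uniq cM eM ke dM kd).
  by rewrite kd.
rewrite (exchange_big_dep (fun d => kappa d == c)) /=; last by move=> M d _ /andP[].
rewrite /GRing.scale /= mulr_sumr; apply: eq_bigr => d /eqP kd.
transitivity (\sum_(M | compatible ((i, c) :: L) S M && ((d, i) \in M)) mark_weight S M).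
  rewrite sum_marks_cons // ffunE -IH //; case: ifP => _; ring.
by apply: eq_bigl => M; rewrite kd eqxx.
Qed.

End MarkSum.
End CellOperators.

(** * Relations between the cell operators of a skew staircase *)

Lemma pairwise_iota m n : pairwise ltn (iota m n).
Proof. by rewrite -(sorted_pairwise ltn_trans) iota_ltn_sorted. Qed.

Lemma pairwise_rev_iota m n : pairwise gtn (rev (iota m n)).
Proof.
rewrite -sorted_pairwise ?rev_sorted ?iota_ltn_sorted // => x y z.
by move=> yx xz; exact: ltn_trans xz yx.
Qed.

Section GridRelations.
Variables (R : comNzRingType) (P : finType) (pos : P -> nat * nat) (N : nat).
(** The three hypotheses describe a set of cells with i + j <= N that is closed to the south and
    east within that triangle, as a skew staircase is. *)
Hypothesis pos_inj : injective pos.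
Hypothesis pos_bound : forall p, ((pos p).1 + (pos p).2 <= N)%N.
Hypothesis pos_up : forall p i j, ((pos p).1 <= i)%N -> ((pos p).2 <= j)%N ->
  (i + j <= N)%N -> exists r, pos r = (i, j).
Implicit Types (d e : P) (S : {set P}) (f : {ffun {set P} -> R^o}).

Definition nw d e : bool :=
  [&& ((pos d).1 <= (pos e).1)%N, ((pos d).2 <= (pos e).2)%N & d != e].

(* The content j - i, shifted by N to be a natural number. *)
Definition content d : nat := ((pos d).2 + (N - (pos d).1))%N.

Local Notation t := (add_cell nw).
Local Notation u := (add_content nw content).

Lemma nwxx : irreflexive nw.
Proof. by move=> d; rewrite /nw eqxx !andbF. Qed.

Lemma nw_coord d e : nw d e ->
  [/\ ((pos d).1 <= (pos e).1)%N, ((pos d).2 <= (pos e).2)%N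
    & ((pos d).1 + (pos d).2 < (pos e).1 + (pos e).2)%N].
Proof.
case/and3P=> h1 h2 /eqP de; split=> //.
rewrite ltn_neqAle leq_add // andbT; apply/eqP => h.
by apply/de/pos_inj; rewrite [LHS]surjective_pairing [RHS]surjective_pairing;
   congr pair; lia.
Qed.

Lemma nwP d e : ((pos d).1 <= (pos e).1)%N -> ((pos d).2 <= (pos e).2)%N ->
  ((pos d).1 + (pos d).2 < (pos e).1 + (pos e).2)%N -> nw d e.
Proof. by move=> h1 h2 h3; apply/and3P; split=> //; apply: contraTneq h3 => ->; lia. Qed.

Lemma nw_content d e : (content d <= (content e).+1)%N ->
  (content e <= (content d).+1)%N -> d != e -> nw d e || nw e d.
Proof.
have := pos_bound d; have := pos_bound e; rewrite /content /nw.
by move=> h1 h2 h3 h4 de; rewrite [e == d]eq_sym de !andbT; lia.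
Qed.

(** The south or the east neighbour of [d] lies on the way to [e], and differs from [e] because
    their contents are not adjacent. *)
Lemma nw_between d e : nw d e ->
  ((content d).+1 != content e) && ((content e).+1 != content d) ->
  exists2 r, nw d r & nw r e.
Proof.
move=> de; have [h1 h2 h3] := nw_coord de.
have := pos_bound d; have := pos_bound e; rewrite /content => r1 r2 h4.
case: (ltnP (pos d).1 (pos e).1) => h5.
  have [||| r pr] := @pos_up d (pos d).1.+1 (pos d).2; [lia|lia|lia|].
  by exists r; apply: nwP; rewrite pr /=; lia.
have [||| r pr] := @pos_up d (pos d).1 (pos d).2.+1; [lia|lia|lia|].
by exists r; apply: nwP; rewrite pr /=; lia.
Qed.

Lemma add_cell_idem d f : t d (t d f) = - t d f.
Proof.
apply/ffunP => S; rewrite !ffunE; case: ifP => //; last by rewrite oppr0.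
move=> /activeP[A1 A2]; rewrite ifT; last first.
  apply/activeP; split=> e l; rewrite in_setU1; first by rewrite A1 ?orbT.
  rewrite negb_or A2 // andbT; apply: contraTneq l => ->.
  by rewrite nwxx.
by rewrite setU11 expr1 setUA setUid; case: (d \in S); rewrite ?expr1 ?expr0; ring.
Qed.

(** Here [d] is read first, and [e] cannot be read once a cell to its south-east is occupied. *)
Lemma add_cell_nw0 d e f : nw e d -> t d (t e f) = 0.
Proof.
move=> ed; apply/ffunP => S; rewrite !ffunE; case: ifP => // _.
case: ifP => [/activeP[_ /(_ d ed)]|]; last by rewrite mulr0.
by rewrite setU11.
Qed.

(** The cell [r] must be free when [d] is read and occupied when [e] is read, but nothing fills it
    in between. *)
Lemma add_cell_between0 d e r f : nw d r -> nw r e -> t d (t e f) = 0.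
Proof.
move=> dr re; apply/ffunP => S; rewrite !ffunE; case: ifP => // /activeP[_ A].
case: ifP => [/activeP[/(_ r re)]|]; last by rewrite mulr0.
rewrite in_setU1 (negbTE (A r dr)) orbF => /eqP rd.
by rewrite rd nwxx in dr.
Qed.

Lemma add_cell_far0 d e f : nw d e || nw e d ->
  ((content d).+1 != content e) && ((content e).+1 != content d) ->
  t d (t e f) = 0.
Proof.
case/orP=> [de far|ed _]; last exact: add_cell_nw0.
by have [r dr re] := nw_between de far; exact: add_cell_between0 dr re.
Qed.

Lemma active_incomparable d e S : ~~ nw d e -> ~~ nw e d ->
  active nw d (e |: S) = active nw d S.
Proof.
move=> nde ned; apply: eq_forallb => r; rewrite !in_setU1.
by case: (eqVneq r e) => // ->; rewrite (negbTE nde) (negbTE ned).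
Qed.

Lemma add_cell_incomparable d e f : ~~ nw d e -> ~~ nw e d ->
  t d (t e f) = t e (t d f).
Proof.
move=> nde ned; case: (eqVneq d e) => [->//|de].
apply/ffunP => S; rewrite !ffunE !active_incomparable //.
rewrite !in_setU1 (negbTE de) eq_sym (negbTE de) /= setUCA.
by case: (active nw d S); case: (active nw e S); rewrite ?mulr0 //; ring.
Qed.

Lemma add_cell_far d e f : ((content d).+1 < content e)%N ->
  t d (t e f) = t e (t d f).
Proof.
move=> far; case: (boolP (nw d e || nw e d)) => [cmp|].
  by rewrite !add_cell_far0 // 1?orbC //; lia.
by rewrite negb_or => /andP[? ?]; exact: add_cell_incomparable.
Qed.

(** Only a chain from [d] through [e] to [d'] could survive. Then one of the south and east
    neighbours of [d] differs from [e]; it is free when [d] is read but would have to be occupied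
    when [d'] is read. *)
Lemma add_cell_braid d e d' f : content d = content d' ->
  (content d).+1 = content e \/ (content e).+1 = content d ->
  t d (t e (t d' f)) = 0.
Proof.
move=> kd ke.
have de : d != e by apply/eqP => de; subst e; case: ke; lia.
have de' : e != d' by apply/eqP => de'; subst e; case: ke; lia.
have [||ndde|] := orP (@nw_content d e _ _ de); [lia|lia| |exact: add_cell_nw0].
have [||nded|] := orP (@nw_content e d' _ _ de'); [lia|lia| |]; last first.
  by move=> l; rewrite (add_cell_nw0 _ l) linear0.
have [h1 h2 h3] := nw_coord ndde; have [h4 h5 h6] := nw_coord nded.
have := pos_bound d; have := pos_bound d'; have := pos_bound e => r1 r2 r3.
move: (kd) (ke); rewrite /content => kd1 ke1.
have [r [dr rd' re]] : exists r, [/\ nw d r, nw r d' & r != e].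
  have [||| r pr] := @pos_up d (pos d).1.+1 (pos d).2; [lia|lia|lia|].
  have [||| s ps] := @pos_up d (pos d).1 (pos d).2.+1; [lia|lia|lia|].
  case: (eqVneq r e) => re; last first.
    by exists r; split=> //; apply: nwP; rewrite pr /=; lia.
  exists s; split; [apply: nwP; rewrite ps /=; lia|apply: nwP; rewrite ps /=; lia|].
  apply/eqP => se; have : pos r = pos s by rewrite se re.
  by rewrite pr ps => -[]; lia.
apply/ffunP => S; rewrite !ffunE; case: ifP => // /activeP[_ /(_ r dr) A].
case: ifP => [_|]; last by rewrite mulr0.
case: ifP => [/activeP[/(_ r rd')]|]; last by rewrite !mulr0.
rewrite !in_setU1 (negbTE re) (negbTE A) orbF /= => /eqP rd.
by rewrite rd nwxx in dr.
Qed.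

Lemma add_content_idem c f : u c (u c f) = - u c f.
Proof.
rewrite {1}/add_content -sumrN; apply: eq_bigr => d /eqP kd.
rewrite /add_content linear_sum (bigD1 d) ?kd //= add_cell_idem big1 ?addr0 //.
move=> e /andP[/eqP ke ed]; apply: add_cell_far0; last by lia.
by apply: nw_content; rewrite 1?eq_sym //; lia.
Qed.

Lemma add_content_comm i j f : (i.+1 < j)%N -> u i (u j f) = u j (u i f).
Proof.
move=> ij; rewrite /add_content.
under eq_bigr do rewrite linear_sum.
under [RHS]eq_bigr do rewrite linear_sum.
rewrite exchange_big; apply: eq_bigr => e /eqP ke; apply: eq_bigr => d /eqP kd.
by apply: add_cell_far; rewrite kd ke.
Qed.

Lemma add_content_braid i j f : j = i.+1 \/ i = j.+1 -> u i (u j (u i f)) = 0.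
Proof.
move=> ij; rewrite {1}/add_content big1 // => d /eqP kd.
rewrite {1}/add_content linear_sum big1 // => e /eqP ke.
rewrite {1}/add_content !linear_sum big1 // => d' /eqP kd'.
by apply: add_cell_braid; rewrite ?kd ?kd' ?ke //; case: ij; auto.
Qed.

(** * Agreement of the two products on the full state *)

Lemma supp_hprod x s S d : hprod u x s (full_state R P) S != 0 ->
  d \notin S -> content d \in s.
Proof.
elim: s S => [|c s IH] S /=.
  by rewrite ffunE; case: (S =P setT) => [->|_]; [rewrite inE | rewrite eqxx].
rewrite inE hfacE !ffunE; move: (hprod u x s _) IH => f IH.
case: (eqVneq (f S) 0) => [->|fS _ dS]; last by rewrite (IH S) ?orbT.
rewrite add0r => nz dS; case: (eqVneq (content d) c) => //= dc.
move: nz; rewrite /add_content sum_ffunE.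
case: (pickP [pred e | (content e == c) && (f (e |: S) != 0)]) => [e|none].
  case/andP=> /eqP ke feS _; apply: (IH (e |: S)) => //.
  rewrite in_setU1 negb_or dS andbT; apply: contra_neq dc => ->.
  exact: ke.
rewrite big1 ?scaler0 ?eqxx // => e kce; rewrite ffunE.
have /negbT := none e; rewrite /= kce /= negbK => /eqP ->.
by rewrite mulr0; case: ifP.
Qed.

(** A cell of odd shifted content has i + j < N, so its south and east neighbours exist, with
    contents c - 1 and c + 1. Both are still free when it is read, so both contents must occur in
    [s], which lies on one side of [c]. *)
Lemma add_content_odd_eq0 c x s : odd c -> all (ltn c) s || all (gtn c) s ->
  u c (hprod u x s (full_state R P)) = 0.
Proof.
move=> oc cs; rewrite /add_content big1 // => d /eqP kd.
apply/ffunP => S; rewrite !ffunE; case: ifP => // /activeP[_ A].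
have := @supp_hprod x s (d |: S); set f := hprod _ _ _ _ => supp_f.
case: (eqVneq (f (d |: S)) 0) => [->|nz]; first by rewrite mulr0.
have pd := pos_bound d; move: (kd); rewrite /content => kd1.
have step i j : ((pos d).1 <= i)%N -> ((pos d).2 <= j)%N ->
    (i + j = ((pos d).1 + (pos d).2).+1)%N -> (j + (N - i))%N \in s.
  move=> di dj ij; have [|||r pr] := @pos_up d i j; [lia|lia| |].
    by move: oc; rewrite -kd1; lia.
  have dr : nw d r by apply: nwP; rewrite pr /=; lia.
  have := supp_f r nz; rewrite /content pr; apply.
  rewrite in_setU1 negb_or A // andbT; apply: contraTneq dr => ->.
  by rewrite nwxx.
have := step (pos d).1.+1 (pos d).2 (leqnSn _) (leqnn _) (addSn _ _).
have := step (pos d).1 (pos d).2.+1 (leqnn _) (leqnSn _) (addnS _ _).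
by case/orP: cs => /allP cs /cs /= h1 /cs /= h2; lia.
Qed.

Lemma hprod_filter_even x s : pairwise ltn s || pairwise gtn s ->
  hprod u x s (full_state R P)
  = hprod u x [seq c <- s | ~~ odd c] (full_state R P).
Proof.
elim: s => //= c s IH cs.
have /IH {}IH : pairwise ltn s || pairwise gtn s.
  by case/orP: cs => /andP[_ ->] //; rewrite orbT.
have {}cs : all (ltn c) s || all (gtn c) s.
  by case/orP: cs => /andP[-> _] //; rewrite orbT.
case: (boolP (odd c)) => oc /=; last by rewrite -IH.
rewrite -IH -!/(hprod _ _ _ _) hfacE.
by rewrite (add_content_odd_eq0 x oc cs) scaler0 addr0.
Qed.

(** Distinct even contents differ by at least 2, so all factors commute. *)
Lemma hprod_rev_even x s f : uniq s -> all (fun c => ~~ odd c) s ->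
  hprod u x (rev s) f = hprod u x s f.
Proof.
elim: s f => //= c s IH f /andP[cs us] /andP[oc os].
rewrite rev_cons -cats1 /hprod foldr_cat /= -!/(hprod _ _ _ _) IH //.
apply: hprod_hfac => [|i j g|]; [exact: add_content_linear|exact: add_content_comm|].
apply/allP => c' c's; have oc' := allP os _ c's.
have : c' != c by apply: contraNneq cs => <-.
by lia.
Qed.

Lemma hup_hdown_full x n :
  hup u x n (full_state R P) = hdown u x n (full_state R P).
Proof.
rewrite /hup /hdown (@hprod_filter_even x (iota 0 n)) ?pairwise_iota //.
rewrite (@hprod_filter_even x (rev (iota 0 n))) ?pairwise_rev_iota ?orbT //.
rewrite filter_rev hprod_rev_even ?filter_uniq ?iota_uniq //.
exact: filter_all.
Qed.

Lemma foldr_hup_hdown_full n s :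
  foldr (fun x => hup u x n) (full_state R P) s
  = foldr (fun x => hdown u x n) (full_state R P) s.
Proof.
apply: foldr_hup_hdown => [i|i f|i j f|i f|i f|x].
- exact: add_content_linear.
- exact: add_content_idem.
- exact: add_content_comm.
- by apply: add_content_braid; left.
- by apply: add_content_braid; right.
- exact: hup_hdown_full.
Qed.

End GridRelations.

(** * Reading by increasing and by decreasing content *)

Section MarkedTableaux.
Variables (P : finType) (K : nat).
Implicit Types (M : {set P * 'I_K}) (r : rel nat).

Definition lex r (a b : 'I_K * nat) : bool :=
  (a.1 < b.1)%N || ((a.1 == b.1) && r a.2 b.2).

Lemma lex_irr r : irreflexive r -> irreflexive (lex r).
Proof. by move=> rxx [i c]; rewrite /lex ltnn rxx andbF. Qed.

Lemma lex_trans r : transitive r -> transitive (lex r).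
Proof.
move=> r_trans [b d] [a c] [e f]; rewrite /lex /=.
case/orP=> [ab|/andP[/eqP<- cd]] /orP[bc|/andP[/eqP<- df]]; apply/orP.
- by left; exact: ltn_trans bc.
- by left.
- by left.
- by right; rewrite eqxx (r_trans _ _ _ cd df).
Qed.

Definition letters (cs : seq nat) : seq ('I_K * nat) :=
  [seq (i, c) | i <- enum 'I_K, c <- cs].

Lemma pairwise_letters r cs : pairwise r cs -> pairwise (lex r) (letters cs).
Proof.
move=> rcs; rewrite /letters.
have : pairwise ltn [seq val i | i <- enum 'I_K].
  by rewrite val_enum_ord pairwise_iota.
rewrite pairwise_map.
elim: (enum 'I_K) => //= i s IH /andP[/allP i_s /IH {}IH].
rewrite pairwise_cat IH andbT; apply/andP; split.
  apply/allrelP => a b /mapP[c _ ->] /allpairsP[[j d] [/i_s ij _ ->]].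
  by apply/orP; left.
rewrite pairwise_map; apply: sub_pairwise rcs => c d cd.
by rewrite /lex /= eqxx cd orbT.
Qed.

Lemma foldr_letters (R : comNzRingType) (X : finType)
    (u : nat -> {ffun X -> R^o} -> {ffun X -> R^o}) (x : 'I_K -> R) cs f :
  foldr (fun l => hfac u (x l.1) l.2) f (letters cs)
  = foldr (fun y => hprod u y cs) f [seq x i | i <- enum 'I_K].
Proof.
rewrite /letters; elim: (enum 'I_K) => //= i s IH.
by rewrite foldr_cat IH /hprod foldr_map.
Qed.

Variables (pos : P -> nat * nat) (N : nat).
Hypothesis pos_inj : injective pos.
Hypothesis pos_bound : forall p, ((pos p).1 + (pos p).2 <= N)%N.
Hypothesis pos_up : forall p i j, ((pos p).1 <= i)%N -> ((pos p).2 <= j)%N ->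
  (i + j <= N)%N -> exists s, pos s = (i, j).

Local Notation cells_compatible r cs :=
  (compatible (nw pos) (content pos N) (lex r) (letters cs) set0).
Local Notation contents := (iota 0 N.*2.+1).

(** Both sums are values at the empty set of operator products applied to the full state, with [hup]
    on the left and [hdown] on the right. *)
Lemma sum_compatible_lex (R : comNzRingType) (x : 'I_K -> R) :
  \sum_(M | cells_compatible ltn contents M) mark_weight x set0 M
  = \sum_(M | cells_compatible gtn (rev contents) M) mark_weight x set0 M.
Proof.
have cmp d e : content pos N d = content pos N e -> d != e ->
    nw pos d e || nw pos e d.
  by move=> de; apply: nw_content => //; rewrite de.
rewrite -!(sum_marks x (nwxx pos)) //.
- rewrite !foldr_letters.
  have E := @foldr_hup_hdown_full R P pos N pos_inj pos_bound pos_up N.*2.+1.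
  by rewrite /hup /hdown in E; rewrite E.
- by apply: lex_irr => c; exact: ltnn.
- by apply: lex_trans => b a c ba ac; exact: ltn_trans ac ba.
- exact/pairwise_letters/pairwise_rev_iota.
- by apply: lex_irr => c; exact: ltnn.
- exact/lex_trans/ltn_trans.
- exact/pairwise_letters/pairwise_iota.
Qed.

Definition marked_svt (p : P -> nat * nat) M : Prop :=
  [/\ forall d, exists i, (d, i) \in M,
      forall d e i j, (d, i) \in M -> (e, j) \in M ->
        (p d).1 = (p e).1 -> ((p d).2 < (p e).2)%N -> (i <= j)%N
    & forall d e i j, (d, i) \in M -> (e, j) \in M ->
        (p d).2 = (p e).2 -> ((p d).1 < (p e).1)%N -> (i < j)%N].

Lemma cells_compatibleP r cs M : (forall d, content pos N d \in cs) ->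
  cells_compatible r cs M <->
  (forall d, exists i, (d, i) \in M) /\
  (forall d e i j, (d, i) \in M -> (e, j) \in M -> nw pos d e ->
    lex r (i, content pos N d) (j, content pos N e)).
Proof.
move=> cs_all; split=> [/compatibleP[_ M2 M3 _]|[M2 M3]].
  split=> [d|d e i j diM ejM]; first by apply: M2; rewrite inE.
  exact: (M3 _ _ diM ejM).
apply/compatibleP; split=> [p _|d _|[d i] [e j]|p e _ _]; rewrite ?inE //.
- apply/allpairsP; exists (letter (content pos N) p); split=> //.
    by rewrite mem_enum.
  exact: cs_all.
- by move=> dM eM; exact: M3.
Qed.

Lemma content_le d : (content pos N d <= N.*2)%N.
Proof. by have := pos_bound d; rewrite /content; lia. Qed.

Lemma between d e : nw pos d e ->
  exists s, pos s = ((pos d).1, (pos e).2).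
Proof.
case/(nw_coord pos_inj) => h1 h2 h3; have := pos_bound e => b.
by apply: (@pos_up d); lia.
Qed.

(** Content grows along rows and drops down columns, so equal values are allowed in rows only. If
    [e] is strictly south and east of [d], the inequalities are chained through the cell in the row
    of [d] and the column of [e]. *)
Lemma compatible_ltnP M : cells_compatible ltn contents M <-> marked_svt pos M.
Proof.
rewrite cells_compatibleP; last by move=> d; rewrite mem_iota ltnS content_le.
(* This bound makes the truncated subtraction in [content] exact. *)
have row d := leq_trans (leq_addr _ _) (pos_bound d).
split=> -[M1].
  move=> M2; split=> // d e i j diM ejM de lde.
    have /(M2 _ _ _ _ diM ejM) : nw pos d e by apply: nwP; lia.
    by rewrite /lex /= => /orP[|/andP[/eqP->]] // /ltnW.
  have /(M2 _ _ _ _ diM ejM) : nw pos d e by apply: nwP; lia.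
  rewrite /lex /= => /orP[|/andP[_]] //.
  by have := row d; have := row e; rewrite /content; lia.
move=> Mrow Mcol; split=> // d e i j diM ejM de.
have [h1 h2 h3] := nw_coord pos_inj de; rewrite /lex /= /content.
have rd := row d; have re := row e.
case: (ltnP (pos d).1 (pos e).1) => [h4|h4]; last first.
  have ij : (i <= j)%N by apply: (Mrow d e i j diM ejM); lia.
  by rewrite -val_eqE /=; lia.
case: (ltnP (pos d).2 (pos e).2) => [h5|h5]; last first.
  by rewrite (Mcol d e i j diM ejM _ _) //; lia.
have [s ps] := between de; have [k skM] := M1 s.
have ik := Mrow d s i k diM skM; have kj := Mcol s e k j skM ejM.
rewrite ps /= in ik kj.
by rewrite (leq_ltn_trans (ik _ _) (kj _ _)).
Qed.

(** Reversing the order of contents exchanges the roles of rows and columns. *)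
Lemma compatible_gtnP M :
  cells_compatible gtn (rev contents) M <-> marked_svt (fun d => ((pos d).2, (pos d).1)) M.
Proof.
rewrite cells_compatibleP; last first.
  by move=> d; rewrite mem_rev mem_iota ltnS content_le.
have row d := leq_trans (leq_addr _ _) (pos_bound d).
split=> -[M1].
  move=> M2; split=> //= d e i j diM ejM de lde.
    have /(M2 _ _ _ _ diM ejM) : nw pos d e by apply: nwP; lia.
    by rewrite /lex /= => /orP[|/andP[/eqP->]] // /ltnW.
  have /(M2 _ _ _ _ diM ejM) : nw pos d e by apply: nwP; lia.
  rewrite /lex /= => /orP[|/andP[_]] //.
  by have := row d; have := row e; rewrite /content; lia.
move=> /= Mcol Mrow; split=> // d e i j diM ejM de.
have [h1 h2 h3] := nw_coord pos_inj de; rewrite /lex /= /content.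
have rd := row d; have re := row e.
case: (ltnP (pos d).2 (pos e).2) => [h4|h4]; last first.
  have ij : (i <= j)%N by apply: (Mcol d e i j diM ejM); lia.
  by rewrite -val_eqE /=; lia.
case: (ltnP (pos d).1 (pos e).1) => [h5|h5]; last first.
  by rewrite (Mrow d e i j diM ejM _ _) //; lia.
have [s ps] := between de; have [k skM] := M1 s.
have ik := Mrow d s i k diM skM; have kj := Mcol s e k j skM ejM.
rewrite ps /= in ik kj.
by rewrite (leq_trans (ik _ _) (kj _ _)).
Qed.

End MarkedTableaux.

(** * Coefficients of stable Grothendieck polynomials *)

From mathcomp Require Import finmap monalg classical_sets fsbigop.

Lemma card_young lam : #|` skew_diagram lam [::]| = sumn lam.
Proof.
have -> : skew_diagram lam [::]
    = [fset c in [seq (i, j) | i <- iota 0 (size lam), j <- iota 0 (nth 0%N lam i)]]%fset.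
  by apply/fsetP => c; rewrite !inE /young nth_nil ltn0 andbT.
rewrite card_fseq undup_id; last first.
  by apply: allpairs_uniq_dep => [|i _|[i j] [k l] _ _ /= [-> ->]]; rewrite ?iota_uniq.
rewrite size_allpairs_dep; congr sumn.
rewrite (eq_map (g := nth 0%N lam)) ?map_nth_iota0 ?take_size //.
by move=> i; rewrite size_iota.
Qed.

Lemma subpartition_young lam mu : subpartition mu lam <->
  (forall c, young mu c -> young lam c).
Proof.
split=> [sub [i j]|sub i]; rewrite /young /=.
  by move=> lt_j; exact: leq_trans lt_j (sub i).
rewrite leqNgt; apply/negP => /(sub (i, nth 0%N lam i)).
by rewrite /young ltnn.
Qed.

Lemma card_skew_diagram lam mu : subpartition mu lam ->
  #|` skew_diagram lam mu| = skew_size lam mu.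
Proof.
move=> /subpartition_young sub.
have -> : skew_diagram lam mu
    = (skew_diagram lam [::] `\` skew_diagram mu [::])%fset.
  apply/fsetP => c; rewrite in_fsetD !in_skew_diagram.
  have -> : young [::] c = false by rewrite /young nth_nil ltn0.
  by rewrite !andbT andbC.
rewrite cardfsDS ?card_young //.
apply/fsubsetP => c; rewrite !in_skew_diagram => /andP[/sub -> ] //.
Qed.

Section Coefficients.
Variables (lam mu : seq nat) (P : finType) (K : nat).
Variables (cell : P -> skew_diagram lam mu) (index : skew_diagram lam mu -> P).
Hypotheses (cellK : cancel cell index) (indexK : cancel index cell).
Implicit Types (M : {set P * 'I_K}) (m : {cmonom nat}).

(** Entries are positive, so the ordinal [i] stands for the entry [i.+1]. *)
Definition filling_of_marks M : filling lam mu :=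
  [ffun c => [fset (i : 'I_K).+1 | i in [set i | (index c, i) \in M]%SET]%fset].

Lemma mem_filling_of_marks M d (i : 'I_K) :
  (i.+1 \in filling_of_marks M (cell d)) = ((d, i) \in M).
Proof.
rewrite ffunE cellK; apply/imfsetP/idP => [[j /= + [ij]]|dM].
  by rewrite inE (val_inj ij).
by exists i; rewrite //= inE.
Qed.

Lemma filling_of_marksP M c j : reflect
  (exists2 i : 'I_K, (index c, i) \in M & j = i.+1) (j \in filling_of_marks M c).
Proof.
rewrite ffunE; apply: (iffP (imfsetP _ _ _ _)) => -[i /= iM ->]; exists i => //.
  by rewrite inE in iM.
by rewrite inE.
Qed.

Definition mark_monomial M : {cmonom nat} := \big[mmul/mone]_(p in M) ucm p.2.+1.

Lemma sum_marks_cells (V : nmodType) M (F : P -> 'I_K -> V) :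
  \sum_(p in M) F p.1 p.2 = \sum_(d : P) \sum_(i | (d, i) \in M) F d i.
Proof. by rewrite pair_big_dep; apply: eq_bigl => -[]. Qed.

Lemma mark_monomialE M j :
  mark_monomial M j = (\sum_(p in M) (p.2.+1 == j))%N.
Proof.
rewrite /mark_monomial (big_morph (fun m : {cmonom nat} => m j) (fun a b => cmM j a b) (cm1 j)).
by apply: eq_bigr => p _; rewrite cmU.
Qed.

Lemma svt_monomial_marks M : svt_monomial (filling_of_marks M) = mark_monomial M.
Proof.
apply/eqP/cmP => j; rewrite svt_monomialE mark_monomialE.
rewrite (sum_marks_cells M (fun _ (i : 'I_K) => (i.+1 == j) : nat)).
rewrite /multiplicity -sum1_card (reindex_onto cell index) => [|c _]; last exact: indexK.
rewrite big_mkcond; apply: eq_bigr => d _; rewrite cellK eqxx andbT inE.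
case: filling_of_marksP => [[i diM ->]|nj].
  rewrite cellK in diM; rewrite (bigD1 i) //= eqxx big1 // => k /andP[_ ki].
  by rewrite eqSS; apply/eqP; rewrite eqb0; apply: contraNneq ki => ki; apply/eqP/val_inj.
rewrite big1 // => i diM; apply/eqP; rewrite eqb0; apply/eqP => ij.
by apply: nj; exists i; rewrite ?cellK.
Qed.

Lemma svt_size_marks M : svt_size (filling_of_marks M) = #|M|.
Proof.
rewrite -sum1_card (sum_marks_cells M (fun _ _ => 1%N)) /svt_size.
rewrite (reindex_onto cell index) => [|c _]; last exact: indexK.
apply: eq_big => d; first by rewrite cellK eqxx.
rewrite ffunE cellK => _; rewrite card_imfset; last first.
  by move=> i k [ik]; exact: val_inj.
rewrite sum1_card cardE; apply/perm_size/uniq_perm => [||i].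
- exact: enum_finmem_uniq.
- exact: enum_uniq.
- by rewrite enum_finmemE mem_enum inE.
Qed.

Definition cell_svt M : Prop := marked_svt (fun d => val (cell d)) M.

Lemma is_svt_marks M : is_svt (filling_of_marks M) <-> cell_svt M.
Proof.
split=> [[T1 _ T3 T4]|[M1 M2 M3]].
  split=> [d|d e i j diM ejM de lde|d e i j diM ejM de lde].
  - have /fset0Pn[j /filling_of_marksP[i]] := T1 (cell d).
    by rewrite cellK; exists i.
  - rewrite -(mem_filling_of_marks M) in diM; rewrite -(mem_filling_of_marks M) in ejM.
    have := T3 (cell d) (cell e) de lde; rewrite /set_le => le.
    exact: leq_trans (leq_trans (leq_fmax diM) le) (geq_fmin ejM).
  - rewrite -(mem_filling_of_marks M) in diM; rewrite -(mem_filling_of_marks M) in ejM.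
    have := T4 (cell d) (cell e) de lde; rewrite /set_lt => lt.
    exact: leq_trans (leq_ltn_trans (leq_fmax diM) lt) (geq_fmin ejM).
have T0 c : filling_of_marks M c != fset0.
  have [i iM] := M1 (index c); apply/fset0Pn; exists i.+1.
  by apply/filling_of_marksP; exists i.
split=> [//|c i /filling_of_marksP[j _ ->] //|c d cd lcd|c d cd lcd].
- have /filling_of_marksP[i iM i1] := fmax_in (T0 c).
  have /filling_of_marksP[j jM j1] := fmin_in (T0 d).
  by rewrite /set_le i1 j1 ltnS; apply: (M2 _ _ _ _ iM jM); rewrite !indexK.
- have /filling_of_marksP[i iM i1] := fmax_in (T0 c).
  have /filling_of_marksP[j jM j1] := fmin_in (T0 d).
  by rewrite /set_lt i1 j1 ltnS; apply: (M3 _ _ _ _ iM jM); rewrite !indexK.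
Qed.

Lemma card_marks M : cell_svt M -> (#|P| <= #|M|)%N.
Proof.
case=> M1 _ _; rewrite -!sum1_card.
rewrite (sum_marks_cells M (fun _ _ => 1%N)); apply: leq_sum => d _.
by have [i iM] := M1 d; rewrite (bigD1 i).
Qed.

Lemma card_cells : #|P| = #|` skew_diagram lam mu|.
Proof. by rewrite cardfE; apply: bij_eq_card (Bijective cellK indexK). Qed.

Lemma filling_of_marks_surj m T : (forall j, j \in finsupp m -> (j <= K)%N) ->
  is_svt T -> svt_monomial T = m -> exists M, T = filling_of_marks M.
Proof.
move=> mK [_ T2 _ _] Tm.
exists [set p : P * 'I_K | p.2.+1 \in T (cell p.1)]%SET.
apply/ffunP => c; apply/fsetP => j; apply/idP/filling_of_marksP => [jT|[i + ->]].
  case: j jT => [/T2 //|j jT].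
  have jK : (j < K)%N.
    apply: mK; rewrite mem_finsupp -Tm svt_monomialE -lt0n.
    by apply/card_gt0P; exists c; rewrite inE.
  by exists (Ordinal jK); rewrite // inE /= indexK.
by rewrite inE /= indexK.
Qed.

Lemma filling_of_marks_inj : injective filling_of_marks.
Proof.
move=> M M' e; apply/setP => -[d i].
by rewrite -!mem_filling_of_marks e.
Qed.

Variable good : pred {set P * 'I_K}.
Hypothesis goodP : forall M, good M <-> cell_svt M.

Lemma stable_grothendieck_marks m : subpartition mu lam ->
  (forall j, j \in finsupp m -> (j <= K)%N) ->
  stable_grothendieck lam mu m
  = \sum_(M | good M && (mark_monomial M == m)) (-1) ^+ (#|M| + #|P|).
Proof.
move=> sub mK; rewrite /stable_grothendieck.
rewrite (@reindex_fsbig _ _ _ _ _ filling_of_marks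
  [set` [pred M | good M && (mark_monomial M == m)]]%classic).
  rewrite -(bigfs _ (index_enum_uniq _)) => [|M _]; last by rewrite mem_index_enum.
  apply: eq_bigr => M /andP[/goodP /card_marks MP _].
  rewrite svt_size_marks -card_skew_diagram // -card_cells.
  (* Since |P| <= |M|, the exponents |M| - |P| and |M| + |P| have the same parity. *)
  by rewrite -[in RHS](subnK MP) -addnA addnn -muln2 exprD exprM sqrr_sign mulr1.
split.
- move=> M /= /andP[/goodP gM /eqP Mm].
  by rewrite svt_monomial_marks; split=> //; apply/is_svt_marks.
- by move=> M M' _ _; exact: filling_of_marks_inj.
- move=> T [svtT Tm]; have [M TM] := filling_of_marks_surj mK svtT Tm.
  exists M => //=; apply/andP; split; last by rewrite -svt_monomial_marks -TM Tm.
  by apply/goodP/is_svt_marks; rewrite -TM.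
Qed.

(** Brings in the operator identities, which hold over any commutative ring: here over the monoid
    algebra, with the variables themselves as weights. *)
Lemma mcoeff_mark_weight m :
  \sum_(M | good M && (mark_monomial M == m)) (-1) ^+ (#|M| + #|P|)
  = (\sum_(M | good M) mark_weight
      (fun i : 'I_K => << ucm i.+1 >> : {malg int[{cmonom nat}]}) finset.set0 M)@_m.
Proof.
rewrite raddf_sum /= big_mkcondr; apply: eq_bigr => M _.
rewrite /mark_weight finset.setC0 cardsT.
have -> : \prod_(p in M) (<< ucm p.2.+1 >> : {malg int[{cmonom nat}]})
    = << mark_monomial M >>.
  rewrite /mark_monomial; apply: (big_ind2 (fun g k => g = << k >>)) => [|_ k _ l -> ->|p _].
  - by rewrite -mpolyC1E.
  - by rewrite malgM_def fgmulUU mulr1.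
  - by [].
rewrite -[in LHS]signr_odd -[in RHS]signr_odd; case: (odd _); rewrite /= ?expr1 ?expr0 ?mulN1r ?mul1r ?mcoeffN mcoeffU1;
  by case: eqP; rewrite ?oppr0.
Qed.

End Coefficients.

(** * Staircase diagrams and transposition *)

Lemma nth_staircase n i : nth 0%N (staircase n) i = (n - i)%N.
Proof.
rewrite /staircase; case: (ltnP i n) => lt_in; last first.
  by rewrite nth_default ?size_rev ?size_iota //; lia.
by rewrite nth_rev ?size_iota // nth_iota; lia.
Qed.

Lemma young_staircase N c : young (staircase N.+1) c = (c.1 + c.2 <= N)%N.
Proof. by rewrite /young nth_staircase; lia. Qed.

Lemma young_up mu i j k l : is_partition mu -> (i <= k)%N -> (j <= l)%N ->
  young mu (k, l) -> young mu (i, j).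
Proof.
case/andP=> smu _ ik jl; rewrite /young /= => l_mu.
apply: leq_ltn_trans jl (leq_trans l_mu _).
case: (ltnP k (size mu)) => [ks|]; last by move/(nth_default 0%N)->.
have := @sorted_leq_nth _ geq _ _ 0%N mu smu i k; apply=> //.
- by move=> x y z yx zy /=; exact: leq_trans zy yx.
- by move=> x /=; exact: leqnn.
- by rewrite inE; exact: leq_ltn_trans ks.
Qed.

Definition swap (c : nat * nat) : nat * nat := (c.2, c.1).

Lemma swapK : involutive swap. Proof. by case. Qed.

Section Transpose.
Variables (lam mu lam' mu' : seq nat).
Hypothesis skewT : forall c,
  (swap c \in skew_diagram lam' mu') = (c \in skew_diagram lam mu).

Definition transpose_cell (c : skew_diagram lam mu) : skew_diagram lam' mu' :=
  FSetSub (etrans (skewT (val c)) (valP c)).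

End Transpose.

Local Close Scope ring_scope.

Theorem theorem1p3 (n : nat) (hn : 1 <= n) (mu : seq nat)
    (mu_part : is_partition mu) (mu_sub : subpartition mu (staircase n)) :
  stable_grothendieck (staircase n) mu
  = stable_grothendieck (staircase n) (conjugate mu).
Proof.
case: n hn mu_sub => // N _ mu_sub.
set rho := staircase N.+1 in mu_sub *.
have conj_young c : young (conjugate mu) (swap c) = young mu c.
  by case: c => i j; rewrite conjugateP.
have conj_sub : subpartition (conjugate mu) rho.
  apply/subpartition_young => c; rewrite -[c]swapK conj_young.
  by move/(proj1 (subpartition_young _ _) mu_sub); rewrite !young_staircase /= addnC.
have skewT c : (swap c \in skew_diagram rho (conjugate mu)) = (c \in skew_diagram rho mu).
  by rewrite !in_skew_diagram conj_young !young_staircase /= addnC.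
have skewT' c : (swap c \in skew_diagram rho mu) = (c \in skew_diagram rho (conjugate mu)).
  by rewrite -skewT swapK.
have cellK : cancel (transpose_cell skewT) (transpose_cell skewT').
  by move=> c; apply: val_inj; exact: swapK.
have cellK' : cancel (transpose_cell skewT') (transpose_cell skewT).
  by move=> c; apply: val_inj; exact: swapK.
have pos_inj : injective (val : skew_diagram rho mu -> nat * nat) by exact: val_inj.
have pos_bound (c : skew_diagram rho mu) : ((val c).1 + (val c).2 <= N)%N.
  by have := valP c; rewrite in_skew_diagram young_staircase => /andP[].
have pos_up (c : skew_diagram rho mu) i j : ((val c).1 <= i)%N ->
    ((val c).2 <= j)%N -> (i + j <= N)%N ->
    exists r : skew_diagram rho mu, val r = (i, j).
  move=> ci cj ij; suff ijP : (i, j) \in skew_diagram rho mu by exists (FSetSub ijP).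
  rewrite in_skew_diagram young_staircase ij /=.
  have := valP c; rewrite in_skew_diagram => /andP[_]; apply: contra.
  by rewrite [val c]surjective_pairing; exact: young_up.
apply/boolp.funext => m.
(* Only the variables occurring in [m] affect this coefficient, so finitely many values suffice. *)
pose K := (\max_(j <- finsupp m) j)%N.
have mK j : j \in finsupp m -> (j <= K)%N by move=> jm; exact: leq_bigmax_seq.
rewrite (stable_grothendieck_marks (cell := id) (index := id) _ _
  (compatible_ltnP pos_inj pos_bound pos_up) mu_sub mK) //.
(* The cells of [rho]/[mu] index this side too, each sent to its transpose. *)
rewrite (stable_grothendieck_marks cellK cellK'
  (compatible_gtnP pos_inj pos_bound pos_up) conj_sub mK).
rewrite !mcoeff_mark_weight; congr (_@__); exact: sum_compatible_lex.
Qed.
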